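(* Let $X$ be a Banach space, $a_0\in\mathbb R\cup\{-\infty\}$, let $\mathcal T=\{T(t,s): t\ge s>a_0\}\subset\mathcal B(X)$ be an invertible evolution family, and let $a_0^*>a_0$ be such that the following hold: (i) $\mathcal T$ exhibits bounded growth and bounded decay on $[a_0^*,\infty)$; (ii) there exists a finite-dimensional subspace $Z\subset X$ such that $X=\mathcal S\oplus Z$, where \[ \mathcal S:=\Big\{v\in X:\ \sup_{t\ge a_0^*}\|T(t,a_0^* )v\|<+\infty\Big\}. \] Then the following statements are equivalent: (a) $\mathcal T$ admits an exponential dichotomy on $[a_0^*,\infty)$; (b) $\mathcal T$ is exponentially expansive on $[a_0^*,\infty)$; (c) $\mathcal T$ is uniformly noncritical on $[a_0^*,\infty)$.
   Context: $X=(X,\|\cdot\|)$ is a Banach space and $\mathcal B(X)$ is the space of bounded linear operators on $X$ with the operator norm, also denoted $\|\cdot\|$; $\mathrm{Id}$ is the identity operator. Evolution family: for $a_0\in\mathbb R\cup\{-\infty\}$, a family $\mathcal T=\{T(t,s): t\ge s>a_0\}\subset\mathcal B(X)$ such that $T(t,t)=\mathrm{Id}$ for $t>a_0$; $T(t,s)T(s,r)=T(t,r)$ for $t\ge s\ge r>a_0$; and for every $s>a_0$ and $v\in X$ the map $t\mapsto T(t,s)v$ is continuous on $[s,\infty)$. It is invertible if each $T(t,s)$, $t\ge s>a_0$, is an invertible operator; in that case one sets $T(t,s):=T(s,t)^{-1}$ for $a_0<t<s$, so that $T(t,s)$ is defined for all $t,s>a_0$. Let $J\subset(a_0,\infty)$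 be an interval and $\mathcal T$ an invertible evolution family. Bounded growth on $J$: there exist $K,\mu>0$ such that $\|T(t,s)\|\le Ke^{\mu(t-s)}$ for all $t,s\in J$ with $t\ge s$. Bounded decay on $J$: there exist $K,\mu>0$ such that $\|T(t,s)\|\le Ke^{\mu(s-t)}$ for all $t,s\in J$ with $t\le s$. Exponential dichotomy on $J$: there exist a family $\{P(t):t\in J\}$ of bounded projections on $X$ and constants $D,\lambda>0$ such that: (1) for $t,s\in J$ with $t\ge s$, $P(t)T(t,s)=T(t,s)P(s)$ and $T(t,s)|_{\operatorname{Ker}P(s)}:\operatorname{Ker}P(s)\to\operatorname{Ker}P(t)$ is invertible; (2) $\|T(t,s)P(s)\|\le De^{-\lambda(t-s)}$ for $t,s\in J$, $t\ge s$; (3) $\|T(t,s)(\mathrm{Id}-P(s))\|\le De^{-\lambda(s-t)}$ for $t,s\in J$, $t\le s$, where here $T(t,s):=(T(s,t)|_{\operatorname{Ker}P(t)})^{-1}:\operatorname{Ker}P(s)\to\operatorname{Ker}P(t)$. Exponentially expansive on $J$: there exist $L,\beta>0$ such that $\|v\|\le L\big(e^{-\beta(t-a)}\|T(a,t)v\|+e^{-\beta(b-t)}\|T(b,t)v\|\big)$ for all $v\in X$ and all $a\le t\le b$ with $[a,b]\subset J$. Uniformly noncritical on $[a_0^*,\infty)$: there exist $\theta\in(0,1)$ and $C>0$ such that $\|v\|\le\theta\sup\{\|T(u,t)v\|: |u-t|\le C\}$ for all $v\in X$ and all $t\ge a_0^*+C$. *)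

(* Defs.v *)
From HB Require Import structures.
From mathcomp Require Import all_boot all_order all_algebra.
From mathcomp Require Import all_classical all_reals all_analysis.
From mathcomp Require Import complex.

Set Implicit Arguments.
Unset Strict Implicit.
Unset Printing Implicit Defensive.

Import Order.TTheory GRing.Theory Num.Theory.
Import numFieldNormedType.Exports.

Local Open Scope classical_set_scope.
Local Open Scope ring_scope.
Local Open Scope complex_scope.

(* A Banach space is a complete normed space over the real or the complex
   numbers; both cases are covered by quantifying over [k : scalar_kind] and
   [X : completeNormedModType (base_field R k)]. *)
Variant scalar_kind := RealScalars | ComplexScalars.

Definition base_field (R : realType) (k : scalar_kind) : numFieldType :=
  match k with
  | RealScalars => R : numFieldType
  | ComplexScalars => R[i] : numFieldType
  end.

Definition real_part (R : realType) (k : scalar_kind) : base_field R k -> R :=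
  match k return base_field R k -> R with
  | RealScalars => fun x => x
  | ComplexScalars => fun z => complex.Re z
  end.

Section Definitions.
Variables (R : realType) (k : scalar_kind).
Variable X : completeNormedModType (base_field R k).
Implicit Types (f S : X -> X) (T : R -> R -> X -> X) (J : set R).

(* The library norm [`|v|] takes its values in the scalar field, where it is a
   nonnegative real; [rnorm v] is the same number as an element of [R]. *)
Definition rnorm (v : X) : R := real_part `|v|.

(* Valued in [\bar R], hence [+oo] exactly when a linear [f] is unbounded. *)
Definition opnorm f : \bar R :=
  ereal_sup [set (rnorm (f v))%:E | v in [set v | rnorm v <= 1]].

Definition bounded_operator f : Prop := linear f /\ (opnorm f < +oo)%E.

Definition ker f : set X := f @^-1` [set 0].

(* Evolution families are total functions [T : R -> R -> X -> X], of which only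
   the values [T t s] with [a0 < s <= t] are meaningful. *)
Definition evolution_family (a0 : \bar R) T : Prop :=
  [/\ forall t s, (a0 < s%:E)%E -> s <= t -> bounded_operator (T t s),
      forall t, (a0 < t%:E)%E -> T t t = id,
      forall t s r, (a0 < r%:E)%E -> r <= s -> s <= t ->
        T t s \o T s r = T t r
    & forall s v, (a0 < s%:E)%E ->
        {within `[s, +oo[, continuous (fun t => T t s v)} ].

(* Inverse in the algebra of bounded operators. *)
Definition invertible_operator f : Prop :=
  exists S, [/\ bounded_operator S, cancel f S & cancel S f].

Definition invertible_family (a0 : \bar R) T : Prop :=
  forall t s, (a0 < s%:E)%E -> s <= t -> invertible_operator (T t s).

(* The extension of an invertible family to all pairs of times:
   [evo T t s] is the inverse of [T s t] when [t < s]. *)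
Definition evo T (t s : R) : X -> X :=
  if s <= t then T t s else 'pinv_(fun=> 0) [set: X] (T s t).

Definition bounded_growth T J : Prop :=
  exists K mu : R, [/\ 0 < K, 0 < mu &
    forall t s, J t -> J s -> s <= t ->
      (opnorm (evo T t s) <= (K * expR (mu * (t - s)))%:E)%E].

Definition bounded_decay T J : Prop :=
  exists K mu : R, [/\ 0 < K, 0 < mu &
    forall t s, J t -> J s -> t <= s ->
      (opnorm (evo T t s) <= (K * expR (mu * (s - t)))%:E)%E].

(* For [t <= s], the inverse of the restriction
   [T s t : ker (P t) -> ker (P s)]; it is only applied to vectors of
   [ker (P s)]. *)
Definition kernel_evo T (P : R -> X -> X) (t s : R) : X -> X :=
  'pinv_(fun=> 0) (ker (P t)) (T s t).

Definition exponential_dichotomy T J : Prop :=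
  exists (P : R -> X -> X) (D lambda : R),
  [/\ 0 < D, 0 < lambda,
      forall t, J t -> bounded_operator (P t) /\ P t \o P t = P t
    & [/\ forall t s, J t -> J s -> s <= t ->
            P t \o T t s = T t s \o P s /\
            set_bij (ker (P s)) (ker (P t)) (T t s),
          forall t s, J t -> J s -> s <= t ->
            (opnorm (T t s \o P s) <= (D * expR (- lambda * (t - s)))%:E)%E
        & forall t s, J t -> J s -> t <= s ->
            (opnorm (kernel_evo T P t s \o (fun v => v - P s v)%R)
               <= (D * expR (- lambda * (s - t)))%:E)%E ] ].

Definition exponentially_expansive T J : Prop :=
  exists L beta : R, [/\ 0 < L, 0 < beta &
    forall (v : X) (a t b : R), a <= t -> t <= b -> `[a, b] `<=` J ->
      rnorm v <= L * (expR (- beta * (t - a)) * rnorm (evo T a t v) +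
                      expR (- beta * (b - t)) * rnorm (evo T b t v))].

(* Uniform noncriticality on the half-line [[astar, +oo[]. *)
Definition uniformly_noncritical T (astar : R) : Prop :=
  exists theta C : R, [/\ 0 < theta < 1, 0 < C &
    forall (v : X) (t : R), astar + C <= t ->
      ((rnorm v)%:E <= theta%:E *
         ereal_sup [set (rnorm (evo T u t v))%:E | u in
                      [set u | (`|u - t| <= C)%R]])%E].

Definition bounded_orbits T (astar : R) : set X :=
  [set v | (ereal_sup [set (rnorm (T t astar v))%:E | t in `[astar, +oo[]
              < +oo)%E].

Definition finite_dim_subspace (Z : set X) : Prop :=
  exists (n : nat) (z : 'I_n -> X),
    Z = [set \sum_(i < n) c i *: z i | c in [set: 'I_n -> base_field R k]].

(* Algebraic direct sum of two linear subspaces. *)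
Definition direct_sum (Y Z : set X) : Prop :=
  (forall v, exists y z, [/\ Y y, Z z & v = y + z]) /\ Y `&` Z = [set 0].

End Definitions.

(* Main.v *)
(* The norm of an orbit at time [t] is at most [theta] times its supremum over
   [t - C, t + C]; hence bounded orbits decay geometrically, and an orbit which
   exceeds its maximal size on [astar, astar + C] has geometrically growing
   running maxima. For vectors of the complement [Z] this excess occurs within a
   uniform time: spanning vectors are adjoined one at a time, and a sequence of
   counterexamples would be Cauchy because of the expansion already known on the
   smaller subspace. Decay on one side and expansion on the other keep the angle
   between the two transported subspaces away from zero, which bounds the
   projections of the dichotomy, without proving first that the space of bounded
   orbits is closed. *)
Require Import Defs.
From HB Require Import structures.
From mathcomp Require Import all_boot all_order all_algebra.
From mathcomp Require Import all_classical all_reals all_analysis.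
From mathcomp Require Import complex.
From mathcomp Require Import ring lra.

Set Implicit Arguments.
Unset Strict Implicit.
Unset Printing Implicit Defensive.

Import Order.TTheory GRing.Theory Num.Theory.
Import numFieldNormedType.Exports.

Local Open Scope classical_set_scope.
Local Open Scope ring_scope.

(** * Real parts of nonnegative scalars, for both fields *)

Section Scalars.
Context {R : realType} {k : scalar_kind}.
Local Notation F := (base_field R k).
Implicit Types x y : F.

Definition of_real (r : R) : F :=
  match k return base_field R k with
  | RealScalars => r
  | ComplexScalars => real_complex R r
  end.

Lemma of_realK : cancel of_real (@real_part R k).
Proof. by rewrite /of_real => r; case: k. Qed.

Lemma of_real_gt0 r : 0 < r -> 0 < of_real r.
Proof. by rewrite /of_real; case: k => //= r0; rewrite ltcR. Qed.

Lemma real_partD x y : real_part (x + y) = real_part x + real_part y.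
Proof. by case: k x y => //= -[a b] [c d]. Qed.

Lemma ler_real_part x y : x <= y -> real_part x <= real_part y.
Proof. by case: k x y => //= x y; rewrite lecE => /andP[]. Qed.

(** Nonnegative complex scalars have zero imaginary part, so their order is that of their real
    parts. This lets norm inequalities move between the field and [R]. *)
Lemma ltr_real_part x y : 0 <= x -> 0 <= y ->
  (real_part x < real_part y) = (x < y).
Proof.
case: k x y => //= x y x0 y0.
by rewrite ltcE (ger0_Im x0) (ger0_Im y0) eqxx.
Qed.

Lemma real_part0 : real_part (0 : F) = 0.
Proof. by case: k. Qed.

Lemma real_part1 : real_part (1 : F) = 1.
Proof. by case: k. Qed.

Lemma real_part_ge0 x : 0 <= x -> 0 <= real_part x.
Proof. by move=> x0; rewrite -real_part0 ler_real_part. Qed.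

Lemma real_part_eq0 x : 0 <= x -> real_part x = 0 -> x = 0.
Proof.
move=> x0 e; apply/eqP; rewrite eq_le x0 andbT -[_ <= _]negbK.
apply/negP => h; have : 0 < x.
  by rewrite lt_neqAle x0 andbT; apply: contra h => /eqP <-.
by rewrite -ltr_real_part // e real_part0 ltxx.
Qed.

Lemma real_partM x y : 0 <= x -> 0 <= y ->
  real_part (x * y) = real_part x * real_part y.
Proof.
case: k x y => //= x y /ger0_Im x0 /ger0_Im y0.
by case: x x0 => a b /= ->; case: y y0 => c d /= ->; rewrite mulr0 subr0.
Qed.

End Scalars.

(** * The norm as a real number *)

Section RealNorm.
Context {R : realType} {k : scalar_kind}.
Local Notation F := (base_field R k).

Definition modulus (c : F) : R := real_part `|c|.

Lemma modulus_ge0 c : 0 <= modulus c. Proof. exact: real_part_ge0. Qed.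

Lemma modulus0 : modulus 0 = 0.
Proof. by rewrite /modulus normr0 real_part0. Qed.

Variable X : completeNormedModType F.
Implicit Types u v w : X.

Lemma rnorm_ge0 v : 0 <= rnorm v. Proof. exact: real_part_ge0. Qed.

Lemma rnorm0 : rnorm (0 : X) = 0.
Proof. by rewrite /rnorm normr0 real_part0. Qed.

Lemma rnorm_eq0 v : rnorm v = 0 -> v = 0.
Proof.
by move/(real_part_eq0 (normr_ge0 _))/eqP; rewrite normr_eq0 => /eqP.
Qed.

Lemma rnorm_gt0 v : v <> 0 -> 0 < rnorm v.
Proof.
by move=> v0; rewrite lt_neqAle rnorm_ge0 andbT; apply/eqP => e;
  apply: v0; exact: rnorm_eq0.
Qed.

Lemma rnormN v : rnorm (- v) = rnorm v.
Proof. by rewrite /rnorm normrN. Qed.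

Lemma rnormZ c v : rnorm (c *: v) = modulus c * rnorm v.
Proof. by rewrite /rnorm normrZ real_partM. Qed.

Lemma rnormD v w : rnorm (v + w) <= rnorm v + rnorm w.
Proof. by rewrite /rnorm -real_partD ler_real_part // ler_normD. Qed.

Lemma rnormB v w : rnorm (v - w) <= rnorm v + rnorm w.
Proof. by rewrite -(rnormN w) rnormD. Qed.

Lemma rnormC v w : rnorm (v - w) = rnorm (w - v).
Proof. by rewrite -rnormN opprB. Qed.

Lemma rnorm_unit v : v <> 0 -> rnorm (`|v|^-1 *: v) = 1.
Proof.
move=> /eqP v0; have n0 : `|v| != 0 by rewrite normr_eq0.
by rewrite /rnorm normrZ normfV normr_id mulVf // real_part1.
Qed.

End RealNorm.

(** * Completeness of the space and of the scalars *)

Section Sequences.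
Context {R : realType} {k : scalar_kind}.
Local Notation F := (base_field R k).

(* Convergence and the Cauchy property are phrased with real moduli, so that
   both scalar fields are treated at once. *)
Definition rcauchy (V : zmodType) (N : V -> R) (u : nat -> V) :=
  forall e, 0 < e -> exists n, forall i j, (n <= i)%N -> (n <= j)%N ->
    N (u i - u j) < e.

Definition rcvg (V : zmodType) (N : V -> R) (u : nat -> V) l :=
  forall e, 0 < e -> exists n, forall i, (n <= i)%N -> N (u i - l) < e.

Lemma normed_complete (K : numFieldType) (V : completeNormedModType K)
    (u : nat -> V) :
  (forall e, 0 < e -> exists n, forall i j, (n <= i)%N -> (n <= j)%N ->
    `|u i - u j| < e) ->
  exists l, forall e, 0 < e -> exists n, forall i, (n <= i)%N -> `|u i - l| < e.
Proof.
move=> cu.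
have : cvg (u @ \oo).
  apply/cauchy_cvgP/cauchy_exP => e e0.
  have [n hn] := cu _ e0; exists (u n).
  exists n => // i /= ni; rewrite -ball_normE /=.
  exact: hn.
move=> /cvg_ex[l /cvgrPdist_lt ul]; exists l => e e0.
have [n _ hn] := ul _ e0; exists n => i ni.
by rewrite distrC; exact: hn.
Qed.

Lemma rnorm_complete (X : completeNormedModType F) (u : nat -> X) :
  rcauchy (@rnorm R k X) u -> exists l, rcvg (@rnorm R k X) u l.
Proof.
move=> cu; have [|l ul] := @normed_complete _ X u.
  move=> e e0; have [|n hn] := cu (real_part e).
    by rewrite -(@real_part0 R k) ltr_real_part // ltW.
  exists n => i j ni nj.
  by rewrite -ltr_real_part ?normr_ge0 ?(ltW e0) //; exact: hn.
exists l => e e0; have [n hn] := ul _ (of_real_gt0 e0).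
exists n => i ni; rewrite /rnorm -[e](@of_realK _ k) ltr_real_part ?hn //.
exact/ltW/of_real_gt0.
Qed.

(** In the complex case the modulus dominates the real and imaginary parts, which are therefore
    Cauchy; it is at most the sum of their absolute values, so their limits recombine. *)
Lemma modulus_complete (u : nat -> F) :
  rcauchy modulus u -> exists l, rcvg modulus u l.
Proof.
rewrite /modulus; case: k u => /= u cu; first exact: normed_complete.
have norm2 (z : R[i]) : complex.Re `|z| <= `|complex.Re z| + `|complex.Im z|.
  case: z => a b; rewrite normc_def /=.
  rewrite -(@ler_pXn2r _ 2) ?nnegrE ?sqrtr_ge0 ?addr_ge0 //.
  rewrite sqr_sqrtr ?addr_ge0 ?sqr_ge0 // sqrrD !real_normK ?num_real //.
  by rewrite lerD2r lerDl mulrn_wge0 // mulr_ge0.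
have reL (z : R[i]) : `|complex.Re z| <= complex.Re `|z|.
  case: z => a b; rewrite normc_def /=.
  rewrite -(@ler_pXn2r _ 2) ?nnegrE ?sqrtr_ge0 //.
  by rewrite sqr_sqrtr ?addr_ge0 ?sqr_ge0 // real_normK ?num_real //
    lerDl sqr_ge0.
have imL (z : R[i]) : `|complex.Im z| <= complex.Re `|z|.
  case: z => a b; rewrite normc_def /=.
  rewrite -(@ler_pXn2r _ 2) ?nnegrE ?sqrtr_ge0 //.
  by rewrite sqr_sqrtr ?addr_ge0 ?sqr_ge0 // real_normK ?num_real //
    lerDr sqr_ge0.
have ReB (z w : R[i]) : complex.Re (z - w) = complex.Re z - complex.Re w.
  by case: z w => a b [].
have ImB (z w : R[i]) : complex.Im (z - w) = complex.Im z - complex.Im w.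
  by case: z w => a b [].
have [|a ha] := @normed_complete R R (fun n => complex.Re (u n)).
  move=> e /cu[n hn]; exists n => i j ni nj.
  by rewrite -ReB (le_lt_trans (reL _)) // hn.
have [|b hb] := @normed_complete R R (fun n => complex.Im (u n)).
  move=> e /cu[n hn]; exists n => i j ni nj.
  by rewrite -ImB (le_lt_trans (imL _)) // hn.
exists (a +i* b)%C => e e0.
have e20 : 0 < e / 2 by rewrite divr_gt0.
have [n hn] := ha _ e20; have [m hm] := hb _ e20.
exists (maxn n m) => i; rewrite geq_max => /andP[ni mi].
rewrite (le_lt_trans (norm2 _)) // ReB ImB /= [e]splitr ltrD //.
  exact: hn.
exact: hm.
Qed.

End Sequences.

(** * Geometric rates and self-improving bounds *)

Section Geometric.
Context {R : realType}.
Implicit Types (theta C r : R).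

Lemma exists_expr_lt theta (A e : R) : 0 < theta < 1 -> 0 < e ->
  exists n, A * theta ^+ n < e.
Proof.
move=> /andP[t0 t1] e0.
have : (fun n => A * theta ^+ n) @ \oo --> A * 0.
  by apply: cvgM; [exact: cvg_cst|apply: cvg_expr; rewrite gtr0_norm].
rewrite mulr0 => /cvgrPdist_lt/(_ _ e0)[n _ hn]; exists n.
have := hn n (leqnn n); rewrite /= sub0r normrN.
exact/le_lt_trans/ler_norm.
Qed.

(** Take for [n] the integer part of [r / C]: since [r / C < n + 1], rounding down costs at most one
    factor [theta^-1]. This turns rates per step of length [C] into exponential rates. *)
Lemma geometric_le_expR theta C r : 0 < theta < 1 -> 0 < C -> 0 <= r ->
  exists n : nat, n%:R * C <= r /\
    theta ^+ n <= theta^-1 * expR (- (- ln theta / C) * r).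
Proof.
move=> /andP[t0 t1] C0 r0; exists (Num.truncn (r / C)); split.
  by rewrite -ler_pdivlMr // truncn_le divr_ge0 // ltW.
have := truncnS_gt (r / C); set n := Num.truncn _; rewrite -natr1 => rn.
rewrite -[X in X ^+ n <= _]lnK ?posrE // -expRM_natl.
rewrite -[X in X^-1 * _]lnK ?posrE // -expRN -expRD ler_expR.
have -> : - ln theta + - (- ln theta / C) * r = - ln theta * (1 - r / C) by ring.
have : 0 < - ln theta by rewrite oppr_gt0 ln_lt0 // t0.
by nra.
Qed.

(** The bound [b0] only makes the supremum [M] of [f] finite. Then [M] is at most [theta * M] or at
    most [p], and the first case forces [M <= 0 <= p]. *)
Lemma le_of_contracting_bound (J : set R) (f : R -> R) theta (p b0 : R) :
  0 <= theta < 1 -> 0 <= p -> (forall s, J s -> f s <= b0) ->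
  (forall b, (forall s, J s -> f s <= b) ->
     forall s, J s -> f s <= Num.max (theta * b) p) ->
  forall s, J s -> f s <= p.
Proof.
move=> /andP[t0 t1] p0 fb0 contr s Js.
have hf : has_sup [set f u | u in J].
  by split; [exists (f s), s|exists b0 => _ [u Ju <-]; exact: fb0].
have fM u : J u -> f u <= sup [set f u | u in J].
  by move=> Ju; apply: ub_le_sup; [exact: hf.2|exists u].
apply: (le_trans (fM _ Js)); set M := sup _.
have : M <= Num.max (theta * M) p.
  by apply: ge_sup; [exact: hf.1|move=> _ [u Ju <-]; exact: contr].
rewrite le_max => /orP[|//] MtM.
apply: le_trans p0; nra.
Qed.

End Geometric.

(* [x] stands for the norm of an orbit, [g r] for a bound on the growth and the
   decay over a time span of length at most [r]. *)
Definition orbit_profile {R : realType} (a C theta : R) (g : R -> R)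
    (x : R -> R) :=
  [/\ forall t : R, 0 <= x t,
      forall t s r : R, a <= t -> a <= s -> `|t - s| <= r -> x t <= g r * x s
    & forall t b : R, a + C <= t -> (forall u, `|u - t| <= C -> x u <= b) ->
        x t <= theta * b].

(** * Geometric decay and growth of orbit norms *)

Section Profiles.
Context {R : realType}.
Variables (a C theta : R) (g : R -> R).
Implicit Types (x : R -> R) (n : nat).

(** On [[s, s + C]] the profile is at most [g C * x s], and later it is at most [theta] times its
    supremum, so [le_of_contracting_bound] removes [b] from the estimate. Each further shift of the
    starting point by [C] gains a factor [theta]. *)
Lemma bounded_profile_decay x b : 0 < C -> 0 < theta < 1 ->
  (forall r, 0 < g r) -> orbit_profile a C theta g x ->
  (forall t, a <= t -> x t <= b) ->
  forall s t n, a <= s -> s + n%:R * C <= t -> x t <= g C * theta ^+ n * x s.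
Proof.
move=> C0 /andP[t0 t1] g0 [x0 xg xc] xb s t n as_ st.
have step b' s' : a <= s' -> (forall u, s' <= u -> x u <= b') ->
    forall u, s' + C <= u -> x u <= theta * b'.
  move=> as' h u su; apply: xc => [|w]; first by lra.
  by rewrite ler_distl => /andP[? ?]; apply: h; lra.
have xp u : s <= u -> x u <= g C * x s.
  apply: (@le_of_contracting_bound _ [set u | s <= u] x theta (g C * x s) b).
  - by rewrite (ltW t0).
  - by rewrite mulr_ge0 // ltW.
  - by move=> v /= sv; apply: xb; lra.
  - move=> b' h v /= sv; rewrite le_max; have [vC|vC] := leP v (s + C).
      by rewrite xg ?orbT //; [lra|rewrite ler_norml; lra].
    by rewrite (step _ s) // ltW.
rewrite mulrAC; elim: n t st => [|n IH] t st.
  by rewrite expr0 mulr1; apply: xp; lra.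
rewrite exprS mulrCA; apply: (step _ (s + n%:R * C)).
- have : 0 <= n%:R * C by rewrite mulr_ge0 // ltW.
  by lra.
- exact: IH.
- by move: st; rewrite -natr1; lra.
Qed.

(** Once [x] has exceeded [g C * x a], its maximum is no longer attained on [[a, a + C]], where
    noncriticality says nothing, so widening the window by [C] multiplies the maximum by at least
    [theta^-1]. The constant depends on [tau] but not on [x], hence is uniform over families of
    orbits. *)
Lemma unbounded_profile_growth tau : 0 < C -> 0 < theta < 1 ->
  (forall r, 0 < g r) -> exists2 M, 0 < M &
  forall x, orbit_profile a C theta g x ->
  (exists2 u, a <= u <= tau & g C * x a < x u) ->
  forall s t n, a <= s -> s + n%:R * C <= t -> x s <= M * theta ^+ n * x t.
Proof.
move=> C0 /andP[t0 t1] g0.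
(* One successor rounds [(tau - a) / C] up, the other leaves a margin [C] after [tau]. *)
pose N := (Num.truncn ((tau - a) / C)).+2.
have tauN : tau + C <= a + N%:R * C.
  have := truncnS_gt ((tau - a) / C); rewrite ltr_pdivrMr // /N.
  by rewrite -[in X in _ -> X]natr1; lra.
have tN0 : 0 < theta ^+ N by rewrite exprn_gt0.
(* The first summand serves [t <= a + N * C], the second later times; dividing by [theta ^+ N] pays
   for the at most [N] steps lost before the growth starts. *)
exists ((g (N%:R * C) + g C) / theta ^+ N); first by rewrite divr_gt0 // addr_gt0.
move=> x [x0 xg xc] [u /andP[au utau] xu] s t n as_ st.
have uC : a + C <= u.
  rewrite leNgt; apply/negP => uC.
  suff : x u <= g C * x a by lra.
  by apply: xg => //; rewrite ler_norml; lra.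
have step b T : u <= T -> (forall v, a <= v <= T + C -> x v <= b) ->
    forall v, a <= v <= T -> x v <= theta * b.
  move=> uT h v /andP[av vT].
  have big w : a + C <= w <= T -> x w <= theta * b.
    move=> /andP[aw wT]; apply: xc => // y.
    by rewrite ler_distl => /andP[? ?]; apply: h; lra.
  (* Before [a + C] the profile stays below [x u], and [u] lies in the range covered by [big]. *)
  have [vC|vC] := leP (a + C) v; first by apply: big; lra.
  apply: le_trans (big u _); last by lra.
  by apply/ltW/le_lt_trans/xu/xg => //; rewrite ler_norml; lra.
have iter b T m : u <= T -> (forall v, a <= v <= T + m%:R * C -> x v <= b) ->
    forall v, a <= v <= T -> x v <= theta ^+ m * b.
  elim: m T => [|m IH] T uT h.
    by rewrite expr0 mul1r; move: h; rewrite mul0r addr0.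
  rewrite exprS -mulrA; apply: step => //; apply: IH; first by lra.
  by move=> v hv; apply: h; move: hv; rewrite -natr1; lra.
have nC0 m : 0 <= m%:R * C by rewrite mulr_ge0 // ltW.
have st' : s <= t by have := nC0 n; lra.
have thn m m' : (m <= m')%N -> theta ^+ m' <= theta ^+ m.
  by move=> h; rewrite ler_wiXn2l // ltW.
have [tN|tN] := leP t (a + N%:R * C).
  have nN : (n <= N)%N.
    rewrite -(ler_nat R) -(ler_pM2r C0); lra.
  apply: (@le_trans _ _ (g (N%:R * C) * x t)).
    by apply: xg; rewrite ?ler_norml; lra.
  rewrite ler_wpM2r // mulrAC ler_pdivlMr //.
  by apply: ler_pM; rewrite ?lerDl ?thn // ltW.
have xt v : a <= v <= t -> x v <= g C * x t.
  apply: (@le_of_contracting_bound _ [set v | a <= v <= t] x theta (g C * x t)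
    (g (t - a) * x t)).
  - by rewrite (ltW t0).
  - by rewrite mulr_ge0 // ltW.
  - by move=> w /= /andP[aw wt]; apply: xg; rewrite ?ler_norml; lra.
  - move=> b h w /= /andP[aw wt]; rewrite le_max; have [vC|vC] := leP (t - C) w.
      by rewrite xg ?orbT //; [lra|rewrite ler_norml; lra].
    rewrite (step b (t - C)) //; [lra| |lra].
    by move=> y; rewrite subrK; exact: h.
(* Truncated subtraction: [m] is 0 when [n <= N]. In all cases [u <= t - m * C], so [m] windows fit
   between [u] and [t]. *)
pose m := (n - N)%N.
have sm : s + m%:R * C <= t.
  by apply: le_trans st; rewrite lerD2l (ler_pM2r C0) ler_nat leq_subr.
have um : u + m%:R * C <= t.
  have [nN|nN] := leqP n N.
    by rewrite /m (eqP nN) mul0r addr0; lra.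
  have : n%:R = N%:R + m%:R :> R by rewrite -natrD subnKC // ltnW.
  by move: st => /[swap] ->; lra.
apply: (@le_trans _ _ (theta ^+ m * (g C * x t))).
  apply: (iter _ (t - m%:R * C)); [lra| |lra].
  by move=> v; rewrite subrK; exact: xt.
rewrite mulrA ler_wpM2r // mulrAC ler_pdivlMr // mulrAC -exprD mulrC.
have gC0 := ltW (g0 C).
apply: ler_pM; rewrite ?exprn_ge0 ?(ltW t0) ?lerDr ?(ltW (g0 _)) //.
by rewrite thn // addnC -leq_subLR.
Qed.

End Profiles.

(** * Closedness and spans, one vector at a time *)

Section Subspaces.
Context {R : realType} {k : scalar_kind}.
Variable X : completeNormedModType (base_field R k).
Implicit Types (V Z : set X) (u v w z : X).

Definition linear_subspace V :=
  [/\ V 0, forall (c : base_field R k) v, V v -> V (c *: v)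
    & forall v w, V v -> V w -> V (v + w)].

Lemma linear_subspaceB V v w : linear_subspace V -> V v -> V w -> V (v - w).
Proof.
by move=> [_ VZ VD] Vv Vw; apply: VD => //; rewrite -scaleN1r; exact: VZ.
Qed.

Lemma linear_subspaceN V v : linear_subspace V -> V v -> V (- v).
Proof. by move=> [_ VZ VD] Vv; rewrite -scaleN1r; exact: VZ. Qed.

Definition seq_closed V :=
  forall (u : nat -> X) l, (forall n, V (u n)) -> rcvg (@rnorm R k X) u l -> V l.

Definition add_line V z : set X :=
  [set w | exists c v, V v /\ w = c *: z + v].

Lemma linear_subspace_add_line V z : linear_subspace V ->
  linear_subspace (add_line V z).
Proof.
move=> [V0 VZ VD]; split.
- by exists 0, 0; rewrite scale0r addr0.
- move=> c _ [d [v [Vv ->]]]; exists (c * d), (c *: v); split; first exact: VZ.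
  by rewrite scalerDr scalerA.
- move=> _ _ [c [v [Vv ->]]] [d [w [Vw ->]]]; exists (c + d), (v + w).
  by split; [exact: VD|rewrite scalerDl addrACA].
Qed.

Lemma add_line_id V z : linear_subspace V -> V z -> add_line V z = V.
Proof.
move=> [V0 VZ VD] Vz; apply/seteqP; split=> [_ [c [v [Vv ->]]]|v Vv].
  by apply: VD => //; exact: VZ.
by exists 0, v; rewrite scale0r add0r.
Qed.

(** If [z] were at distance zero from [V], points of [V] within [1 / (n + 1)] of it would converge
    to [z], against closedness. Scaling by [c] then shows that the coefficient of [z] depends
    continuously on the vector. *)
Lemma seq_closed_distance V z : linear_subspace V -> seq_closed V -> ~ V z ->
  exists2 d : R, 0 < d &
    forall c v, V v -> d * modulus c <= rnorm (c *: z + v).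
Proof.
move=> sV cV nVz.
have [d d0 hd] : exists2 d : R, 0 < d & forall v, V v -> d <= rnorm (z - v).
  apply: contrapT => far; apply: nVz.
  have /choice[u hu] n : exists v, V v /\ rnorm (z - v) < n.+1%:R^-1.
    apply: contrapT => hn; apply: far.
    exists n.+1%:R^-1; first by rewrite invr_gt0.
    by move=> v Vv; rewrite leNgt; apply/negP => lt; apply: hn; exists v.
  apply: (cV u) => [n|e e0]; first by case: (hu n).
  exists (Num.truncn e^-1) => i ni.
  rewrite rnormC (lt_trans (hu i).2) // invf_plt ?posrE //.
  by rewrite (lt_le_trans (truncnS_gt _)) // ler_nat.
exists d => // c v Vv; have [->|c0] := eqVneq c 0.
  by rewrite modulus0 mulr0 rnorm_ge0.
have -> : c *: z + v = c *: (z - - (c^-1 *: v)).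
  by rewrite opprK scalerDr scalerA mulfV // scale1r.
rewrite rnormZ mulrC ler_wpM2l ?modulus_ge0 // hd //.
by apply: linear_subspaceN => //; case: sV => _ VZ _; exact: VZ.
Qed.

(** By [seq_closed_distance] the coefficients of [z] along a convergent sequence are Cauchy.
    Subtracting their limit times [z] leaves a convergent sequence in [V]. *)
Lemma seq_closed_add_line V z : linear_subspace V -> seq_closed V ->
  seq_closed (add_line V z).
Proof.
move=> sV cV; have [Vz|nVz] := pselect (V z); first by rewrite add_line_id.
have [d d0 hd] := seq_closed_distance sV cV nVz.
move=> u l /choice[c /choice[v cv]] ul.
have cauchy_u : rcauchy (@rnorm R k X) u.
  move=> e e0; have [n hn] := ul (e / 2) (divr_gt0 e0 (ltr0n _ 2)).
  exists n => i j ni nj; have -> : u i - u j = (u i - l) - (u j - l).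
    by rewrite opprB addrA subrK.
  apply: le_lt_trans (rnormB _ _) _.
  by have := hn i ni; have := hn j nj; lra.
have [|c' hc'] := @modulus_complete R k c.
  move=> e e0; have [n hn] := cauchy_u (d * e) (mulr_gt0 d0 e0).
  exists n => i j ni nj; rewrite -(ltr_pM2l d0).
  apply: le_lt_trans (hn i j ni nj).
  rewrite (cv i).2 (cv j).2 opprD addrACA -scalerBl.
  by apply: hd; apply: linear_subspaceB => //; [exact: (cv i).1|exact: (cv j).1].
exists c', (l - c' *: z); split; last by rewrite addrC subrK.
apply: (cV v) => [n|e e0]; first exact: (cv n).1.
have [n hn] := ul (e / 2) (divr_gt0 e0 (ltr0n _ 2)).
pose q := rnorm z + 1; have q0 : 0 < q by rewrite ltr_wpDl ?rnorm_ge0.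
have [m hm] := hc' (e / 2 / q) (divr_gt0 (divr_gt0 e0 (ltr0n _ 2)) q0).
exists (maxn n m) => i; rewrite geq_max => /andP[ni mi].
have -> : v i - (l - c' *: z) = (u i - l) - (c i - c') *: z.
  rewrite (cv i).2 scalerBl !opprB [c i *: z + v i]addrC -!addrA; congr (_ + _).
  by rewrite [RHS]addrC -!addrA addNr addr0 addrC.
apply: le_lt_trans (rnormB _ _) _.
rewrite rnormZ; have := hn i ni; have := hm i mi.
rewrite ltr_pdivlMr // /q mulrDr mulr1.
by have := modulus_ge0 (c i - c'); lra.
Qed.

Definition linear_span n (z : 'I_n -> X) : set X :=
  [set \sum_(i < n) c i *: z i | c in [set: 'I_n -> base_field R k]].

Lemma linear_span0 (z : 'I_0 -> X) : linear_span z = [set 0].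
Proof.
apply/seteqP; split=> [_ [c _ <-]|_ ->]; first by rewrite big_ord0.
by exists (fun=> 0) => //; rewrite big_ord0.
Qed.

Lemma linear_spanS n (z : 'I_n.+1 -> X) :
  linear_span z = add_line (linear_span (fun i => z (lift ord0 i))) (z ord0).
Proof.
apply/seteqP; split=> [_ [c _ <-]|_ [c [_ [[d _ <-] ->]]]].
  rewrite big_ord_recl; exists (c ord0),
    (\sum_(i < n) c (lift ord0 i) *: z (lift ord0 i)).
  by split=> //; exists (fun i => c (lift ord0 i)).
exists (fun i => if unlift ord0 i is Some j then d j else c) => //.
rewrite big_ord_recl unlift_none; congr (_ + _).
by apply: eq_bigr => i _; rewrite liftK.
Qed.

Lemma linear_subspace_span n (z : 'I_n -> X) : linear_subspace (linear_span z).
Proof.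
elim: n z => [|n IH] z; last by rewrite linear_spanS; exact: linear_subspace_add_line.
rewrite linear_span0.
by split=> // [c v ->|v w -> ->]; rewrite ?scaler0 ?addr0.
Qed.

End Subspaces.

(** * Maps satisfying the bare predicate [linear] *)

Section LinearMaps.
Context {K : numFieldType} {X Y : lmodType K}.
Variable f : X -> Y.
Hypothesis lin : linear f.

Lemma linear_mapD v w : f (v + w) = f v + f w.
Proof. by have := lin 1 v w; rewrite !scale1r. Qed.

Lemma linear_map0 : f 0 = 0.
Proof. by apply: (addrI (f 0)); rewrite -linear_mapD !addr0. Qed.

Lemma linear_mapZ c v : f (c *: v) = c *: f v.
Proof. by have := lin c v 0; rewrite linear_map0 !addr0. Qed.

Lemma linear_mapN v : f (- v) = - f v.
Proof. by rewrite -scaleN1r linear_mapZ scaleN1r. Qed.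

Lemma linear_mapB v w : f (v - w) = f v - f w.
Proof. by rewrite linear_mapD linear_mapN. Qed.

End LinearMaps.

(** * Noncritical flows *)

Section Flow.
Context {R : realType} {k : scalar_kind}.
Variable X : completeNormedModType (base_field R k).
Implicit Types (v w y z : X) (Z : set X).

(* The data used from an invertible evolution family on [[a, +oo[]: [U t s] is
   defined for all [t, s >= a], and [g r] bounds it when [|t - s| <= r]. *)
Definition flow (a : R) (g : R -> R) (U : R -> R -> X -> X) :=
  [/\ forall t s : R, a <= t -> a <= s -> linear (U t s),
      forall t v, a <= t -> U t t v = v,
      forall t s r v, a <= t -> a <= s -> a <= r -> U t s (U s r v) = U t r v,
      forall r, 0 < g r
    & forall (t s r : R) v, a <= t -> a <= s -> `|t - s| <= r ->
        rnorm (U t s v) <= g r * rnorm v].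

(** The supremum of [uniformly_noncritical] is replaced by an arbitrary upper bound [b], which keeps
    extended reals out of the estimates. *)
Definition noncritical (a C theta : R) (U : R -> R -> X -> X) :=
  forall v (t b : R), a + C <= t ->
    (forall u, `|u - t| <= C -> rnorm (U u t v) <= b) -> rnorm v <= theta * b.

(** * Expansion on the complement, and its angle with the bounded orbits *)

Section Splitting.
Variables (a C theta : R) (g : R -> R) (U : R -> R -> X -> X).
Hypotheses (flowU : flow a g U) (ncU : noncritical a C theta U).
Hypotheses (C0 : 0 < C) (theta01 : 0 < theta < 1).

Definition bounded_orbit v := exists b, forall t, a <= t -> rnorm (U t a v) <= b.

(** The unstable half of a dichotomy in discrete form, with [n] counting steps of length [C] and one
    [M] for all of [Z]. *)
Definition expanding_on Z M := forall z (s t : R) n, Z z -> a <= s ->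
  s + n%:R * C <= t -> rnorm (U s a z) <= M * theta ^+ n * rnorm (U t a z).

Lemma flowD t v w : a <= t -> U t a (v + w) = U t a v + U t a w.
Proof. by case: flowU => L _ _ _ _ at_; rewrite (linear_mapD (L _ _ _ _)). Qed.

Lemma flowB t v w : a <= t -> U t a (v - w) = U t a v - U t a w.
Proof. by case: flowU => L _ _ _ _ at_; rewrite (linear_mapB (L _ _ _ _)). Qed.

Lemma flowZ t c v : a <= t -> U t a (c *: v) = c *: U t a v.
Proof. by case: flowU => L _ _ _ _ at_; rewrite (linear_mapZ (L _ _ _ _)). Qed.

Lemma flow_id v : U a a v = v.
Proof. by case: flowU => _ I _ _ _; rewrite I. Qed.

Lemma flow_le t v : a <= t -> rnorm (U t a v) <= g (t - a) * rnorm v.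
Proof. by case: flowU => _ _ _ _ G at_; rewrite G // ger0_norm // subr_ge0. Qed.

(** Noncriticality at time [t] is applied to [U t a v], whose images under [U u t] are points of the
    same orbit by the cocycle identity. *)
Lemma flow_profile v : orbit_profile a C theta g (fun t => rnorm (U t a v)).
Proof.
case: flowU => _ _ cocycle _ G; split=> [t|t s r at_ as_ ts|t b at_ h].
- exact: rnorm_ge0.
- by rewrite -(cocycle t s a v) // G.
- have c0 := C0; apply: (ncU at_) => u ut; rewrite cocycle //; first exact: h.
    by move: ut; rewrite ler_distl => /andP[]; lra.
  by lra.
Qed.

Lemma bounded_orbit_decay y s t n : bounded_orbit y -> a <= s ->
  s + n%:R * C <= t ->
  rnorm (U t a y) <= g C * theta ^+ n * rnorm (U s a y).
Proof.
case: flowU => _ _ _ g0 _ [b hb].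
exact: bounded_profile_decay C0 theta01 g0 (flow_profile y) hb s t n.
Qed.

Lemma bounded_orbitD v w :
  bounded_orbit v -> bounded_orbit w -> bounded_orbit (v + w).
Proof.
move=> [b hb] [c hc]; exists (b + c) => t at_.
by rewrite flowD // (le_trans (rnormD _ _)) // lerD ?hb ?hc.
Qed.

Lemma bounded_orbitZ c v : bounded_orbit v -> bounded_orbit (c *: v).
Proof.
move=> [b hb]; exists (modulus c * b) => t at_.
by rewrite flowZ // rnormZ ler_wpM2l ?modulus_ge0 ?hb.
Qed.

(* If no such [tau] existed, there would be [v_n] in [Z] such that [z + v_n]
   grows by at most [g C] up to time [a + n]. Expansion on [Z] makes [v_n]
   bounded, then Cauchy, and the orbit of [z + lim v_n] is bounded. *)
Lemma uniform_escape_time Z z M : linear_subspace Z -> seq_closed Z -> 0 < M ->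
  expanding_on Z M -> ~ Z z ->
  (forall w, add_line Z z w -> bounded_orbit w -> w = 0) ->
  exists tau, forall v, Z v ->
    exists2 u, a <= u <= tau & g C * rnorm (z + v) < rnorm (U u a (z + v)).
Proof.
move=> sZ cZ M0 eZ nZz triv.
have c0 := C0; have /andP[t0 t1] := theta01.
have [_ _ _ g0 _] := flowU.
apply: contrapT => no_tau.
have /choice[v hv] n : exists v, Z v /\
    forall s, a <= s <= a + n%:R -> rnorm (U s a (z + v)) <= g C * rnorm (z + v).
  apply: contrapT => h; apply: no_tau; exists (a + n%:R) => v Zv.
  apply: contrapT => h'; apply: h; exists v; split=> // s sn.
  by rewrite leNgt; apply/negP => lt; apply: h'; exists s.
have nC0 n : 0 <= n%:R * C by rewrite mulr_ge0 // ltW.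
have natgt (r : R) : exists N : nat, r <= N%:R.
  by exists (Num.truncn r).+1; apply/ltW/truncnS_gt.
have [r [N [r0 vr]]] : exists r N, 0 <= r /\
    forall n, (N <= n)%N -> rnorm (z + v n) <= r.
  (* After [j] steps expansion makes the image of [v n] at least [2 * g C] times as large as [v n],
     while the slow growth of [z + v n] bounds that image by a constant plus [g C * rnorm (v n)].
     Absorbing the last term bounds [v n]. *)
  have [j hj] := @exists_expr_lt _ theta (M * (2 * g C)) 1
    theta01 ltr01.
  have [N hN] := natgt (j%:R * C).
  pose s := a + j%:R * C; have as_ : a <= s by have := nC0 j; rewrite /s; lra.
  exists (rnorm z + (rnorm (U s a z) + g C * rnorm z) / g C), N; split.
    by rewrite addr_ge0 ?rnorm_ge0 // divr_ge0 ?addr_ge0 ?mulr_ge0 ?rnorm_ge0 ?ltW.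
  move=> n Nn; apply: (le_trans (rnormD _ _)); rewrite lerD2l ler_pdivlMr //.
  have := eZ (v n) a s j (hv n).1 (lexx a) (lexx _); rewrite flow_id.
  have : rnorm (U s a (v n)) <=
      rnorm (U s a z) + g C * (rnorm z + rnorm (v n)).
    have -> : v n = (z + v n) - z by rewrite addrC addKr.
    rewrite flowB // (le_trans (rnormB _ _)) // addrC lerD2l.
    apply: (@le_trans _ _ (g C * rnorm (z + v n))).
      apply: (hv n).2; rewrite as_ /= /s lerD2l (le_trans hN) // ler_nat //.
    rewrite ler_wpM2l ?(ltW (g0 _)) // addrAC subrr add0r.
    exact: rnormD.
  set A := rnorm (U s a (v n)); set q := rnorm (v n) => hA hq.
  have q0 : 0 <= q := rnorm_ge0 _; have A0 : 0 <= A := rnorm_ge0 _.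
  have gC := g0 C; have : 2 * g C * q <= A.
    have : 2 * g C * q <= 2 * g C * (M * theta ^+ j * A).
      by rewrite ler_wpM2l // mulr_ge0 // ltW.
    have -> : 2 * g C * (M * theta ^+ j * A) = M * (2 * g C) * theta ^+ j * A by ring.
    move/le_trans; apply; rewrite -[leRHS]mul1r ler_wpM2r // ltW //.
  by move: hA; lra.
have gC := g0 C.
(* At time [s] both [z + v m] and [z + v n] have size at most [g C * r]; pulling their difference,
   which is in [Z], back to time [a] shrinks it by [M * theta ^+ j]. *)
have cauchy_v : rcauchy (@rnorm R k X) v.
  move=> e e0.
  have [j hj] := @exists_expr_lt _ theta (M * (2 * g C * r)) e theta01 e0.
  have [N' hN'] := natgt (j%:R * C).
  pose s := a + j%:R * C; have as_ : a <= s by have := nC0 j; rewrite /s; lra.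
  have small n : (maxn N N' <= n)%N -> rnorm (U s a (z + v n)) <= g C * r.
    rewrite geq_max => /andP[Nn Nn'].
    apply: (@le_trans _ _ (g C * rnorm (z + v n))).
      by apply: (hv n).2; rewrite as_ /= /s lerD2l (le_trans hN') // ler_nat.
    by rewrite ler_wpM2l ?(ltW gC) // vr.
  exists (maxn N N') => m n Nm Nn; apply: le_lt_trans hj.
  have := eZ (v m - v n) a s j
    (linear_subspaceB sZ (hv m).1 (hv n).1) (lexx a) (lexx _).
  rewrite flow_id => /le_trans; apply.
  have -> : M * (2 * g C * r) * theta ^+ j = M * theta ^+ j * (2 * g C * r) by ring.
  rewrite ler_wpM2l ?mulr_ge0 ?exprn_ge0 ?(ltW M0) ?(ltW t0) //.
  have -> : v m - v n = (z + v m) - (z + v n) by rewrite opprD addrACA subrr add0r.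
  rewrite flowB // (le_trans (rnormB _ _)) //.
  by have := small _ Nm; have := small _ Nn; lra.
have [l vl] := rnorm_complete cauchy_v.
have Zl : Z l by apply: (cZ v) => // n; exact: (hv n).1.
have zl0 : z + l = 0.
  apply: triv; first by exists 1, l; rewrite scale1r.
  (* For each [s] the index [n] is taken so large that [v n - l] contributes at most 1 at time [s];
     the resulting bound is independent of [s]. *)
  exists (g C * r + 1) => s as_.
  have gs := g0 (s - a).
  have [N1 h1] := vl _ (divr_gt0 ltr01 gs).
  have [N2 h2] := natgt (s - a).
  pose n := maxn (maxn N N1) N2.
  have [Nn N1n N2n] : [/\ (N <= n)%N, (N1 <= n)%N & (N2 <= n)%N].
    by rewrite /n !leq_max !leqnn !orbT.
  have -> : z + l = (z + v n) - (v n - l) by rewrite opprB addrA addrAC addrK.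
  rewrite flowB // (le_trans (rnormB _ _)) // lerD //.
    apply: (@le_trans _ _ (g C * rnorm (z + v n))).
      apply: (hv n).2; rewrite as_ /= addrC -lerBlDr (le_trans h2) // ler_nat //.
    by rewrite ler_wpM2l ?(ltW gC) // vr.
  rewrite (le_trans (flow_le _ as_)) //.
  by have /ltW := h1 n N1n; rewrite ler_pdivlMr // mulrC.
apply: nZz; have -> : z = - l by apply/eqP; rewrite -addr_eq0 zl0.
exact: linear_subspaceN.
Qed.

(** A vector [c *: z + v] with [c] nonzero is a multiple of [z + c^-1 *: v], whose escape time is
    uniform in [v], so a single growth constant [M1] covers all of these. Vectors with [c = 0] use
    [M], and the sum serves both cases. *)
Lemma expanding_add_line Z z M : linear_subspace Z -> seq_closed Z -> 0 < M ->
  expanding_on Z M ->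
  (forall w, add_line Z z w -> bounded_orbit w -> w = 0) ->
  exists2 M', 0 < M' & expanding_on (add_line Z z) M'.
Proof.
move=> sZ cZ M0 eZ triv.
have [Zz|nZz] := pselect (Z z); first by exists M; rewrite ?add_line_id.
have [tau htau] := uniform_escape_time sZ cZ M0 eZ nZz triv.
have [_ _ _ g0 _] := flowU; have /andP[t0 t1] := theta01.
have [M1 M10 hM1] := @unbounded_profile_growth _ a _ _ _ tau C0 theta01 g0.
exists (M + M1); first by rewrite addr_gt0.
move=> _ s t n [c [v [Zv ->]]] as_ st.
have at_ : a <= t.
  by rewrite (le_trans as_) // (le_trans _ st) // lerDl mulr_ge0 // ltW.
rewrite mulrDl mulrDl.
have tn0 := exprn_gt0 n t0.
have [->|c0] := eqVneq c 0.
  rewrite scale0r add0r (le_trans (eZ v s t n Zv as_ st)) // lerDl.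
  by rewrite !mulr_ge0 ?rnorm_ge0 // ltW.
have -> : c *: z + v = c *: (z + c^-1 *: v).
  by rewrite scalerDr scalerA mulfV // scale1r.
have Zcv : Z (c^-1 *: v) by case: sZ => _ VZ _; exact: VZ.
rewrite !flowZ // !rnormZ.
apply: (@le_trans _ _ (M1 * theta ^+ n * (modulus c * rnorm (U t a (z + c^-1 *: v))))).
  rewrite mulrCA ler_wpM2l ?modulus_ge0 //.
  apply: (hM1 _ (flow_profile _)) => //.
  by rewrite flow_id; exact: htau.
by rewrite lerDr !mulr_ge0 ?rnorm_ge0 ?modulus_ge0 // ltW.
Qed.

Lemma expanding_span n (z : 'I_n -> X) :
  (forall w, linear_span z w -> bounded_orbit w -> w = 0) ->
  exists2 M, 0 < M & expanding_on (linear_span z) M.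
Proof.
move=> triv.
(* Closedness joins the induction because adjoining the next vector requires it. *)
suff [_ //] : seq_closed (linear_span z) /\
  exists2 M, 0 < M & expanding_on (linear_span z) M.
elim: n z triv => [|n IH] z triv.
  rewrite linear_span0; split.
    move=> u l u0 ul; apply: rnorm_eq0; apply/eqP; rewrite eq_le rnorm_ge0 andbT.
    apply/ler_addgt0Pl => e e0; have [m hm] := ul e e0.
    by have := hm m (leqnn m); rewrite (u0 m) sub0r rnormN addr0 => /ltW.
  exists 1 => // _ s t m -> as_ _.
  have [L _ _ _ _] := flowU.
  rewrite (linear_map0 (L _ _ as_ (lexx a))) rnorm0.
  by rewrite mul1r mulr_ge0 ?rnorm_ge0 // exprn_ge0 //; case/andP: theta01 => /ltW.
rewrite linear_spanS in triv *.
have [|cZ [M M0 eZ]] := IH (fun i => z (lift ord0 i)).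
  move=> w Zw; apply: triv; exists 0, w; split=> //.
  by rewrite scale0r add0r.
have sZ := linear_subspace_span (fun i => z (lift ord0 i)).
by split; [exact: seq_closed_add_line|exact: expanding_add_line eZ triv].
Qed.

(** If [y + z] were small compared with [z] at time [s], then [y] and [z] would have nearly the same
    size there and stay close for a fixed time [r], although [z] expands and [y] does not. *)
Lemma uniform_angle Z M : 0 < M -> expanding_on Z M ->
  exists2 c, 0 < c & forall y z s, bounded_orbit y -> Z z -> a <= s ->
    rnorm (U s a z) <= c * rnorm (U s a (y + z)).
Proof.
move=> M0 eZ; have /andP[t0 t1] := theta01.
have [_ _ cocycle g0 G] := flowU; have gC := g0 C.
have [n hn] := @exists_expr_lt _ theta (M * (2 * g C)) 1 theta01 ltr01.
pose r := n%:R * C; have r0 : 0 <= r by rewrite mulr_ge0 // ltW.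
have gr := g0 r; have e0 : 0 < M * theta ^+ n by rewrite mulr_gt0 ?exprn_gt0.
(* By the choice of [n], the term in [rnorm (U s a z)] on the right has coefficient below 1/2;
   absorbing it produces the factor 2. *)
exists (2 * (M * theta ^+ n) * (g r + g C)).
  by rewrite !mulr_gt0 // ?addr_gt0 ?exprn_gt0.
move=> y z s by_ Zz as_; have at_ : a <= s + r by lra.
have := eZ z s (s + r) n Zz as_ (lexx _).
have : rnorm (U (s + r) a z) <=
    g r * rnorm (U s a (y + z)) + g C * (rnorm (U s a (y + z)) + rnorm (U s a z)).
  have -> : U (s + r) a z = U (s + r) a (y + z) - U (s + r) a y.
    by rewrite flowD // [RHS]addrC addKr.
  rewrite (le_trans (rnormB _ _)) // lerD //.
    rewrite -(cocycle (s + r) s a) // G //.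
    by rewrite addrAC subrr add0r ger0_norm.
  apply: (@le_trans _ _ (g C * rnorm (U s a y))).
    apply: le_trans (bounded_orbit_decay by_ as_ (lexx (s + n%:R * C))) _.
    by rewrite ler_wpM2r ?rnorm_ge0 // ler_piMr ?(ltW gC) // exprn_ile1 // ltW.
  rewrite ler_wpM2l ?(ltW gC) //.
  have -> : U s a y = U s a (y + z) - U s a z by rewrite flowD // addrK.
  exact: rnormB.
set A := rnorm (U (s + r) a z); set q := rnorm (U s a z).
set V := rnorm _ => hA hq.
have q0 : 0 <= q := rnorm_ge0 _; have V0 : 0 <= V := rnorm_ge0 _.
move: e0 hn hq; rewrite mulrAC; set eps := M * theta ^+ n => e0 hn hq.
have : eps * A <= eps * (g r * V + g C * (V + q)) by rewrite ler_wpM2l // ltW.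
have : eps * (2 * g C) * q <= 1 * q by rewrite ler_wpM2r // ltW.
by nra.
Qed.

End Splitting.
End Flow.

(** * Operator norm and pointwise bounds *)

Section Operators.
Context {R : realType} {k : scalar_kind}.
Local Notation F := (base_field R k).
Variable X : completeNormedModType F.
Implicit Types (f : X -> X) (v : X).

Lemma opnorm_le f (c : R) : 0 <= c ->
  (forall v, rnorm (f v) <= c * rnorm v) -> (opnorm f <= c%:E)%E.
Proof.
move=> c0 fc; apply: ge_ereal_sup => _ [v /= v1 <-].
by rewrite lee_fin (le_trans (fc v)) // ler_piMr.
Qed.

Lemma le_opnorm f (c : R) v : linear f ->
  (opnorm f <= c%:E)%E -> rnorm (f v) <= c * rnorm v.
Proof.
move=> lf fc; have [->|v0] := pselect (v = 0).
  by rewrite (linear_map0 lf) rnorm0 mulr0.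
have u1 := rnorm_unit v0; set u := _ *: v in u1.
have : rnorm (f u) <= c.
  rewrite -lee_fin; apply: le_trans fc; apply: ereal_sup_ubound.
  by exists u => //=; rewrite u1.
move: u1; rewrite /u (linear_mapZ lf) !rnormZ => u1.
have vp := rnorm_gt0 v0; set m := modulus _ in u1 *.
have m0 : 0 < m by have := modulus_ge0 (`|v|^-1); rewrite -/m; nra.
by move=> h; rewrite -(ler_pM2l m0) (le_trans h) // mulrCA u1 mulr1.
Qed.

Lemma bounded_operatorI f (c : R) : linear f -> 0 <= c ->
  (forall v, rnorm (f v) <= c * rnorm v) -> bounded_operator f.
Proof.
move=> lf c0 fc; split=> //.
exact: le_lt_trans (opnorm_le c0 fc) (ltry _).
Qed.

End Operators.

(** * From evolution families to flows, and the three implications *)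

Section Evolution.
Context {R : realType} {k : scalar_kind}.
Variable X : completeNormedModType (base_field R k).
Variables (a0 : \bar R) (T : R -> R -> X -> X) (a : R).
Hypotheses (evolT : evolution_family a0 T) (invT : invertible_family a0 T).
Hypothesis (a0a : (a0 < a%:E)%E).
Implicit Types (t s r : R) (v w : X).

Local Notation U := (evo T).

Lemma times_gt t : a <= t -> (a0 < t%:E)%E.
Proof. by move=> at_; rewrite (lt_le_trans a0a) // lee_fin. Qed.

Lemma evoE t s : s <= t -> U t s = T t s.
Proof. by rewrite /evo => ->. Qed.

Lemma family_id t v : a <= t -> T t t v = v.
Proof. by move=> /times_gt; case: evolT => _ I _ _ /I ->. Qed.

Lemma family_comp t s r v : a <= r -> r <= s -> s <= t -> T t s (T s r v) = T t r v.
Proof.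
by move=> /times_gt ar rs st; case: evolT => _ _ c _; rewrite -(c t s r).
Qed.

Lemma family_inj t s : a <= s -> s <= t -> injective (T t s).
Proof. by move=> /times_gt as_ /(invT as_)[S [_ /can_inj]]. Qed.

Lemma evoK t s v : a <= s -> s <= t -> U s t (T t s v) = v.
Proof.
move=> as_ st; rewrite /evo; case: ifPn => [ts|_].
  have <- : s = t by apply/eqP; rewrite eq_le st.
  by rewrite !family_id.
rewrite pinvKV ?in_setT // => x y _ _; exact: family_inj.
Qed.

Lemma evoKV t s v : a <= s -> s <= t -> T t s (U s t v) = v.
Proof.
move=> as_ st; have [S [_ _ SK]] := invT (times_gt as_) st.
by rewrite -[in LHS](SK v) evoK.
Qed.

(** Passing through the initial time reduces the cocycle identity to cancellations, without a case
    for every ordering of three times. *)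
Lemma evo_factor t s v : a <= t -> a <= s -> U t s v = T t a (U a s v).
Proof.
move=> at_ as_; have [st|ts] := leP s t.
  by rewrite evoE // -[in LHS](evoKV v (lexx a) as_) family_comp.
rewrite -[in LHS](evoKV v (lexx a) as_) -(family_comp _ (lexx a) at_ (ltW ts)).
by rewrite evoK // ltW.
Qed.

Lemma evo_comp t s r v : a <= t -> a <= s -> a <= r -> U t s (U s r v) = U t r v.
Proof.
move=> at_ as_ ar; rewrite (evo_factor (U s r v) at_ as_) (evo_factor v as_ ar).
by rewrite evoK // -evo_factor.
Qed.

Lemma evo_id t v : a <= t -> U t t v = v.
Proof. by move=> at_; rewrite evoE // family_id. Qed.

Lemma evo_linear t s : a <= t -> a <= s -> linear (U t s).
Proof.
have lT t' s' : a <= s' -> s' <= t' -> linear (T t' s').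
  by move=> /times_gt as_ st; case: evolT => b _ _ _; case: (b t' s' as_ st).
move=> at_ as_; have [st|/ltW ts] := leP s t; first by rewrite evoE //; exact: lT.
move=> c v w; apply: (family_inj at_ ts).
by rewrite evoKV // (lT _ _ at_ ts) !evoKV.
Qed.

Lemma evo_flow : bounded_growth T `[a, +oo[ -> bounded_decay T `[a, +oo[ ->
  exists g, flow a g U.
Proof.
move=> [K [mu [K0 mu0 hK]]] [L [nu [L0 nu0 hL]]].
have mem t : a <= t -> `[a, +oo[%classic t by move=> at_ /=; rewrite in_itv /= at_.
exists (fun r => K * expR (mu * r) + L * expR (nu * r)); split.
- exact: evo_linear.
- exact: evo_id.
- exact: evo_comp.
- by move=> r; rewrite addr_gt0 // mulr_gt0 // expR_gt0.
move=> t s r v at_ as_; rewrite ler_norml => /andP[tr rt].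
rewrite mulrDl; have lU := evo_linear at_ as_.
have [st|/ltW ts] := leP s t.
  apply: ler_wpDr; first by rewrite !mulr_ge0 ?expR_ge0 ?rnorm_ge0 // ltW.
  apply: le_trans (le_opnorm v lU (hK _ _ (mem _ at_) (mem _ as_) st)) _.
  by rewrite ler_wpM2r ?rnorm_ge0 // ler_pM2l // ler_expR ler_pM2l //.
apply: ler_wpDl; first by rewrite !mulr_ge0 ?expR_ge0 ?rnorm_ge0 // ltW.
apply: le_trans (le_opnorm v lU (hL _ _ (mem _ at_) (mem _ as_) ts)) _.
by rewrite ler_wpM2r ?rnorm_ge0 // ler_pM2l // ler_expR ler_pM2l //; lra.
Qed.

(** With [v = U t s w], invariance gives [w - P s w = T s t (v - P t v)], and [v - P t v] lies in
    the kernel of [P t], where the partial inverse undoes [T s t]. *)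
Lemma kernel_evoE (P : R -> X -> X) t s w : a <= t -> t <= s ->
  linear (P t) -> P t \o P t = P t -> P s \o T s t = T s t \o P t ->
  kernel_evo T P t s (w - P s w) = U t s w - P t (U t s w).
Proof.
move=> at_ ts lP PP PT; have as_ : a <= s by exact: le_trans ts.
rewrite -[in LHS](evoKV w at_ ts); set v := U t s w.
have -> : P s (T s t v) = T s t (P t v) := congr1 (@^~ v) PT.
have <- : T s t (v - P t v) = T s t v - T s t (P t v).
  by rewrite -evoE // (linear_mapB (evo_linear as_ at_)).
rewrite /kernel_evo pinvKV //.
  by move=> x y _ _; exact: family_inj.
rewrite inE /ker /= (linear_mapB lP) -[P t (P t v)]/((P t \o P t) v) PP.
exact: subrr.
Qed.

Lemma noncritical_evo theta C : 0 < theta ->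
  (forall v t, a + C <= t -> ((rnorm v)%:E <= theta%:E *
     ereal_sup [set (rnorm (U u t v))%:E | u in [set u | (`|u - t| <= C)%R]])%E) ->
  noncritical a C theta U.
Proof.
move=> t0 h v t b at_ hb; rewrite -lee_fin EFinM.
apply: le_trans (h v t at_) _; apply: lee_wpmul2l; first by rewrite lee_fin ltW.
by apply: ge_ereal_sup => _ [u /= ut <-]; rewrite lee_fin; exact: hb.
Qed.

Lemma bounded_orbitsP v : bounded_orbits T a v <-> bounded_orbit a U v.
Proof.
split=> [sup_fin|[b hb]].
  exists (fine (ereal_sup [set (rnorm (T t a v))%:E | t in `[a, +oo[])) => t at_.
  rewrite evoE //.
  have le_sup t' : a <= t' -> ((rnorm (T t' a v))%:E <=
      ereal_sup [set (rnorm (T t a v))%:E | t in `[a, +oo[])%E.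
    move=> at'; apply: ereal_sup_ubound.
    by exists t' => //=; rewrite in_itv /= at'.
  rewrite -lee_fin fineK ?le_sup // fin_numElt sup_fin andbT.
  exact: lt_le_trans (ltNyr _) (le_sup a (lexx a)).
apply: (@le_lt_trans _ _ b%:E); last exact: ltry.
apply: ge_ereal_sup => _ [t /= + <-]; rewrite in_itv /= andbT => at_.
by rewrite lee_fin -evoE //; exact: hb.
Qed.

(** Split [v] into [P t v], estimated from the left end of the interval, and [v - P t v], estimated
    from the right end. *)
Lemma dichotomy_expansive : exponential_dichotomy T `[a, +oo[ ->
  exponentially_expansive T `[a, +oo[.
Proof.
move=> [P [D [lambda [D0 l0 PP [PT PD QD]]]]].
have mem t : a <= t -> `[a, +oo[%classic t by move=> at_ /=; rewrite in_itv /= at_.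
exists D, lambda; split=> // v p t q pt tq pqJ.
have ap : a <= p.
  have : `[a, +oo[%classic p by apply: pqJ; rewrite /= in_itv /= lexx (le_trans pt).
  by rewrite /= in_itv /= andbT.
have at_ := le_trans ap pt; have aq := le_trans at_ tq.
have lU s r : a <= s -> a <= r -> linear (U s r) := @evo_linear s r.
have lP s : a <= s -> linear (P s) by move=> /mem/PP[[]].
have Pv : rnorm (P t v) <= D * expR (- lambda * (t - p)) * rnorm (U p t v).
  have -> : P t v = (T t p \o P p) (U p t v).
    rewrite -(PT t p (mem _ at_) (mem _ ap) pt).1 /= evoKV //.
  apply: le_opnorm (PD t p (mem _ at_) (mem _ ap) pt).
  move=> c x y /=; rewrite (lP _ ap) -evoE //; exact: lU.
have Qv : rnorm (v - P t v) <= D * expR (- lambda * (q - t)) * rnorm (U q t v).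
  have QE w := kernel_evoE w at_ tq (lP _ at_) (PP _ (mem _ at_)).2
                 (PT q t (mem _ aq) (mem _ at_) tq).1.
  have -> : v - P t v = (kernel_evo T P t q \o (fun v => v - P q v)) (U q t v).
    by rewrite /= QE evo_comp // evo_id.
  apply: le_opnorm (QD t q (mem _ at_) (mem _ aq) tq).
  move=> c x y; rewrite /= !QE (lU _ _ at_ aq) (lP _ at_) scalerBr.
  by rewrite opprD addrACA.
rewrite -[v in leLHS](subrK (P t v)) (le_trans (rnormD _ _)) //.
by rewrite mulrDr !mulrA addrC lerD.
Qed.

Lemma expansive_noncritical : exponentially_expansive T `[a, +oo[ ->
  uniformly_noncritical T a.
Proof.
move=> [L [beta [L0 b0 h]]].
(* Expansivity on [[t - C, t + C]] gives the factor [2 * L * expR (- beta * C)]. With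
   [C = 2 * L / beta] it is [x * expR (- x)] at [x = 2 * L], below 1 because [expR x >= 1 + x]. *)
pose theta := L * 2 * expR (- (L * 2)).
exists theta, (L * 2 / beta); split; last first.
- move=> v t at_.
  set C := L * 2 / beta in at_ *; have C0 : 0 < C by rewrite divr_gt0 // mulr_gt0.
  have bC : - beta * C = - (L * 2) by rewrite /C; field; rewrite gt_eqF.
  have : rnorm v <= theta * Num.max (rnorm (U (t - C) t v)) (rnorm (U (t + C) t v)).
    have := h v (t - C) t (t + C).
    rewrite opprB addrCA subrr addr0 [t + C - t]addrAC subrr add0r bC.
    move=> /(_ _ _ _)/le_trans; apply; [by lra|by lra| |].
      move=> u /=; rewrite !in_itv /= andbT => /andP[? _]; lra.
    rewrite /theta -mulrDr -!mulrA ler_pM2l // mulrCA ler_pM2l ?expR_gt0 //.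
    by rewrite mulr_natl mulr2n lerD // le_max lexx ?orbT.
  rewrite -lee_fin EFinM => /le_trans; apply; apply: lee_wpmul2l.
    by rewrite lee_fin !mulr_ge0 ?expR_ge0 // ltW.
  rewrite EFin_max ge_max; apply/andP; split; apply: ereal_sup_ubound.
    exists (t - C) => //=; rewrite addrAC subrr add0r normrN ger0_norm //.
    exact: ltW.
  exists (t + C) => //=; rewrite addrAC subrr add0r ger0_norm //; exact: ltW.
- by rewrite divr_gt0 // mulr_gt0.
rewrite !mulr_gt0 ?expR_gt0 //= /theta expRN ltr_pdivrMr ?expR_gt0 // mul1r.
by apply: lt_le_trans (expR_ge1Dx _); rewrite ltrDr.
Qed.

(** * Construction of the dichotomy from the splitting *)

Section Dichotomy.
Variables (C theta : R) (g : R -> R) (Z : set X) (M : R).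
Hypotheses (C0 : 0 < C) (theta01 : 0 < theta < 1) (flowU : flow a g U).
Hypotheses (ncU : noncritical a C theta U).
Hypotheses (M0 : 0 < M) (expZ : expanding_on a C theta U Z M).
Hypotheses (linZ : linear_subspace Z).
Hypotheses (sumZ : forall v, exists y, bounded_orbit a U y /\ Z (v - y)).
Hypotheses (triv : forall z, Z z -> bounded_orbit a U z -> z = 0).

(** Linearity and idempotence follow from uniqueness of the decomposition. Continuity is not claimed
    at this stage; it comes from the angle estimate. *)
Lemma projection_along : exists p : X -> X, [/\ linear p, p \o p = p &
  forall v, bounded_orbit a U (p v) /\ Z (v - p v)].
Proof.
have [p hp] := choice sumZ.
have uniq v y : bounded_orbit a U y -> Z (v - y) -> p v = y.
  move=> by_ Zy; have [bp Zp] := hp v; apply/eqP; rewrite -subr_eq0; apply/eqP.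
  apply: triv.
    have -> : p v - y = (v - y) - (v - p v) by rewrite opprB [RHS]addrC addrA subrK.
    exact: linear_subspaceB.
  apply: (bounded_orbitD flowU) => //; rewrite -scaleN1r.
  exact: (bounded_orbitZ flowU).
exists p; split=> //.
  move=> c v w; have [bv Zv] := hp v; have [bw Zw] := hp w.
  apply: uniq.
    by apply: (bounded_orbitD flowU) => //; exact: (bounded_orbitZ flowU).
  rewrite opprD addrACA -scalerBr; case: linZ => _ ZZ ZD.
  by apply: ZD => //; exact: ZZ.
apply/funext => v /=; apply: uniq; first exact: (hp v).1.
by rewrite subrr; case: linZ.
Qed.

Lemma dichotomy_of_splitting : exponential_dichotomy T `[a, +oo[.
Proof.
have /andP[t0 t1] := theta01; have [_ _ _ g0 _] := flowU.
have [c c0 hc] := uniform_angle flowU ncU C0 theta01 M0 expZ.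
have [p [lp pp hp]] := projection_along.
(* Transporting [p] along the evolution makes the invariance automatic. *)
pose P t := T t a \o p \o U a t.
have mem t : `[a, +oo[%classic t -> a <= t by rewrite /= in_itv /= andbT.
have lU s r : a <= s -> a <= r -> linear (U s r) := @evo_linear s r.
have lP t : a <= t -> linear (P t).
  move=> at_ d x y; rewrite /P /= -evoE //.
  by rewrite (lU _ _ (lexx a) at_) lp (lU _ _ at_ (lexx a)).
have PP t : a <= t -> P t \o P t = P t.
  move=> at_; apply/funext => v; rewrite /P /= evoK //.
  by rewrite -[p (p _)]/((p \o p) _) pp.
have PT t s : a <= s -> s <= t -> P t \o T t s = T t s \o P s.
  move=> as_ st; have at_ := le_trans as_ st; apply/funext => v; rewrite /P /=.
  by rewrite family_comp // -[T t s v]/(T t s v) -(evoE st) evo_comp.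
have QE t v : a <= t -> v - P t v = U t a (U a t v - p (U a t v)).
  move=> at_; rewrite (linear_mapB (lU _ _ at_ (lexx a))) evo_comp // evo_id //.
  by rewrite evoE.
(* The angle estimate at time [t], for the two components of [U a t v], bounds the complementary
   projection uniformly in [t]. *)
have QZ t v : a <= t -> rnorm (v - P t v) <= c * rnorm v.
  move=> at_; have [b Zv] := hp (U a t v).
  have := hc _ _ t b Zv at_; rewrite -QE // [p _ + _]addrC subrK.
  by rewrite evo_comp // evo_id.
have PS t v : a <= t -> rnorm (P t v) <= (1 + c) * rnorm v.
  move=> at_; rewrite -[P t v](subKr v) (le_trans (rnormB _ _)) //.
  by rewrite mulrDl mul1r lerD2l QZ.
(* Decay through [P s] costs [g C * (1 + c)], expansion through its complement costs [M * c];
   [theta^-1] is the rounding loss of [geometric_le_expR]. *)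
pose D := (g C * (1 + c) + M * c) / theta.
have gC := g0 C.
have D0 : 0 < D by rewrite divr_gt0 // addr_gt0 // mulr_gt0 // addr_gt0.
exists P, D, (- ln theta / C); split.
- exact: D0.
- by rewrite divr_gt0 // oppr_gt0 ln_lt0 // t0.
- move=> t /mem at_; split; last exact: PP.
  apply: (@bounded_operatorI _ _ _ _ (1 + c)); first exact: lP.
    by rewrite addr_ge0 // ltW.
  by move=> v; exact: PS.
split.
- move=> t s /mem at_ /mem as_ st; split; first exact: PT.
  have PTv v : P t (T t s v) = T t s (P s v) := congr1 (@^~ v) (PT _ _ as_ st).
  split.
  + rewrite /ker => v /= Pv.
    by rewrite PTv Pv -evoE // (linear_map0 (lU _ _ at_ as_)).
  + by move=> x y _ _; exact: family_inj.
  + rewrite /ker => v /= Pv; exists (U s t v); last exact: evoKV.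
      apply: (family_inj as_ st); rewrite -PTv evoKV // Pv -evoE //.
    by rewrite (linear_map0 (lU _ _ at_ as_)).
- move=> t s /mem at_ /mem as_ st.
  apply: opnorm_le => [|v]; first by rewrite mulr_ge0 ?expR_ge0 // ltW.
  have [|n [nC hn]] := @geometric_le_expR _ theta C (t - s) theta01 C0.
    by rewrite subr_ge0.
  have [b _] := hp (U a s v).
  have := bounded_orbit_decay flowU ncU C0 theta01 b as_ (_ : s + n%:R * C <= t).
  have -> : U t a (p (U a s v)) = (T t s \o P s) v.
    by rewrite /P /= family_comp // evoE.
  have -> : U s a (p (U a s v)) = P s v by rewrite evoE.
  move=> /(_ _)/le_trans; apply; first by lra.
  apply: (@le_trans _ _ (g C * theta ^+ n * ((1 + c) * rnorm v))).
    by rewrite ler_wpM2l ?PS // mulr_ge0 ?exprn_ge0 // ltW.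
  rewrite [leLHS]mulrA ler_wpM2r ?rnorm_ge0 // mulrAC /D -[leRHS]mulrA.
  by apply: ler_pM; rewrite ?exprn_ge0 ?mulr_ge0 ?addr_ge0 ?lerDl ?mulr_ge0 // ltW.
- move=> t s /mem at_ /mem as_ ts.
  apply: opnorm_le => [|v]; first by rewrite mulr_ge0 ?expR_ge0 // ltW.
  have [|n [nC hn]] := @geometric_le_expR _ theta C (s - t) theta01 C0.
    by rewrite subr_ge0.
  rewrite /= (kernel_evoE v at_ ts (lP _ at_) (PP _ at_) (PT _ _ at_ ts)).
  rewrite QE // evo_comp //.
  have [b Zv] := hp (U a s v).
  apply: le_trans (expZ Zv at_ (_ : t + n%:R * C <= s)) _; first by lra.
  rewrite -QE //.
  apply: (@le_trans _ _ (M * theta ^+ n * (c * rnorm v))).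
    by rewrite ler_wpM2l ?QZ // mulr_ge0 ?exprn_ge0 // ltW.
  rewrite [leLHS]mulrA ler_wpM2r ?rnorm_ge0 // mulrAC /D -[leRHS]mulrA.
  apply: ler_pM => //; rewrite ?exprn_ge0 ?mulr_ge0 ?(ltW t0) ?(ltW M0) ?(ltW c0) //.
  by rewrite lerDr mulr_ge0 ?addr_ge0 // ltW.
Qed.

End Dichotomy.

Lemma noncritical_dichotomy :
  bounded_growth T `[a, +oo[ -> bounded_decay T `[a, +oo[ ->
  (exists Z, finite_dim_subspace Z /\ direct_sum (bounded_orbits T a) Z) ->
  uniformly_noncritical T a -> exponential_dichotomy T `[a, +oo[.
Proof.
move=> growthT decayT [_ [[n [z ->]] [sumZ trivZ]]] [theta [C [theta01 C0 nc]]].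
have /andP[t0 _] := theta01.
have [g flowU] := evo_flow growthT decayT.
have ncU := noncritical_evo t0 nc.
have triv w : linear_span z w -> bounded_orbit a U w -> w = 0.
  move=> Zw /bounded_orbitsP bw.
  by have : (bounded_orbits T a `&` linear_span z) w by []; rewrite trivZ.
have [M M0 expZ] := expanding_span flowU ncU C0 theta01 triv.
apply: (dichotomy_of_splitting C0 theta01 flowU ncU M0 expZ) => // [|v].
  exact: linear_subspace_span.
have [y [w [/bounded_orbitsP by_ Zw ->]]] := sumZ v.
by exists y; rewrite addrC addKr.
Qed.

End Evolution.

Theorem theorem1 (R : realType) (k : scalar_kind)
    (X : completeNormedModType (base_field R k))
    (a0 : \bar R) (ha0 : a0 != +oo%E)
    (T : R -> R -> X -> X)
    (evolT : evolution_family a0 T) (invT : invertible_family a0 T)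
    (astar : R) (hastar : (a0 < astar%:E)%E)
    (growthT : bounded_growth T `[astar, +oo[)
    (decayT : bounded_decay T `[astar, +oo[)
    (splitT : exists Z : set X,
       finite_dim_subspace Z /\ direct_sum (bounded_orbits T astar) Z) :
  (exponential_dichotomy T `[astar, +oo[ <->
   exponentially_expansive T `[astar, +oo[) /\
  (exponentially_expansive T `[astar, +oo[ <->
   uniformly_noncritical T astar).
Proof.
have ab := @dichotomy_expansive R k X a0 T astar evolT invT hastar.
have bc := @expansive_noncritical R k X T astar.
have ca := noncritical_dichotomy evolT invT hastar growthT decayT splitT.
by split; [split=> [/ab|/bc/ca]|split=> [/bc|/ca/ab]].
Qed.
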